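(* For each integer $i\ge-1$ and all $n\ge 2i+4$: (1) $\#\mathcal{C}_i(n)>0$; (2) every element of $\mathcal{C}_i(n)$ has a plus-full-set, i.e. $\#\mathcal{N}_i(n)=0$; (3) $\mathcal{C}_i(n)$ is the disjoint union $\biguplus_{j\in[3i+4]}\mathcal{F}_i^j(n)$, where each $\mathcal{F}_i^j(n)$, $j\in[3i+4]$, is nonempty.
   Context: Young diagrams use English notation: a Young diagram of shape $\lambda=(\lambda_1\ge\lambda_2\ge\cdots)$ has $\lambda_j$ left-justified boxes in row $j$; rows indexed top to bottom from 1, columns left to right from 1; $(x,y)$ is the box in row $x$, column $y$; $\emptyset$ is the null diagram. Set $\lambda_j=0$ beyond the last nonempty row and $\lambda_0=+\infty$. $\delta_m=(m,m-1,\dots,1)$ for $m\ge1$, $\delta_m=\emptyset$ for $m\le0$; $[m]=\{1,\dots,m\}$. For a Young diagram $Y$ and $d\ge1$, the height of the prime path of row $d$ is $h_Y(d)=\min\{h\ge1:\lambda_{d-h}\ge\lambda_d+h\}$. If $B$ is the last box of row $x_B$, the $B$-strip is the set of last boxes of rows $x_B-h_Y(x_B)+1,\dots,x_B$. $B$ is a corner box if it is the last box of its row and lowest in its column. $Y'\gtrdot Y$ ($Y'$ covers $Y$) if $Y'$ is obtained from $Y$ by deleting the $B$-strip of a corner box $B$ of $Y$. The Tamari lattice $\mathcal T_n$ is the set of Young diagrams contained in $\delta_{n-1}$ under the order generated by this covering; maximal chains are $\emptyset=Y_0\gtrdot\cdots\gtrdot Y_l=\delta_{n-1}$, of length $l$.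 A tableau $T$ fills a Young diagram with positive integers, strictly increasing along rows, weakly increasing down columns, with label set exactly $[l]$, $l=l(T)$; $T(x,y)$ is the label of $(x,y)$; the $r$-set is the set of boxes labelled $r$; $T^{(r)}$ consists of the boxes with labels $\le r$; the end-box of a nonempty set of boxes is its box in the row of largest index. A $\psi$-tableau is a tableau $T$ with $sh(T^{(r-1)})\gtrdot sh(T^{(r)})$ for all $r\in[l(T)]$; maximal chains of $\mathcal T_n$ of length $l$ are identified with $\psi$-tableaux of shape $\delta_{n-1}$ and length $l$. For a $\psi$-tableau $C$ of shape $\delta_{n-1}$, the outer diagonal is $\{(k,n-k):k\in[n-1]\}$. The $r$-set is a full-set if it contains a box of row 1 and its end-box lies in the outer diagonal, say at $(k,n-k)$; it is a plus-full-set ($r^+$-full-set) if moreover $k=n-1$, or $k\le n-2$ and $C(k+1,n-k-1)<r$. $\mathcal C_i(n)$ is the set of $\psi$-tableaux of shape $\delta_{n-1}$ and length $n+i$; for $r\in[n+i]$, $\mathcal F_i^r(n)$ is the set of $C\in\mathcal C_i(n)$ whose $r$-set is a plus-full-set while no $j$-set with $j\in[r-1]$ is a plus-full-set; $\mathcal N_i(n)$ is the set of $C\in\mathcal C_i(n)$ with no plus-full-set. *)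

(* Defs.v *)
From mathcomp Require Import all_boot all_order all_algebra finmap.
From mathcomp Require Import boolp classical_sets functions cardinality.

Set Implicit Arguments.
Unset Strict Implicit.
Unset Printing Implicit Defensive.

Local Open Scope classical_set_scope.

(** A Young diagram is the list of the lengths of its nonempty rows. Boxes are
    pairs (x, y) of natural numbers; rows and columns are numbered from 1. *)

Definition diagram := seq nat.

Definition is_young (Y : diagram) : bool := sorted geq Y && (0 \notin Y).

(* Meant for j >= 1: [row_len Y 0] is junk, and the convention that row 0 is
   infinite is put in by hand in [prime_cond]. *)
Definition row_len (Y : diagram) (j : nat) : nat := nth 0 Y j.-1.

Definition box := (nat * nat)%type.

Definition boxes (Y : diagram) : set box :=
  [set b | 1 <= b.1 /\ 1 <= b.2 <= row_len Y b.1].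

Definition delta (m : nat) : diagram := rev (iota 1 m).

(* h >= 1 and lambda_(d - h) >= lambda_d + h, where lambda_0 = +oo. As h = d
   satisfies the condition when d >= 1, truncating d - h does not affect the
   minimum. *)
Definition prime_cond (Y : diagram) (d h : nat) : bool :=
  (1 <= h) && ((d - h == 0) || (row_len Y d + h <= row_len Y (d - h))).

Lemma prime_cond_ex (Y : diagram) (d : nat) : exists h, prime_cond Y d h.
Proof. by exists d.+1; rewrite /prime_cond subnS subnn. Qed.

Definition prime_height (Y : diagram) (d : nat) : nat :=
  ex_minn (prime_cond_ex Y d).

Definition last_box (Y : diagram) (b : box) : Prop :=
  boxes Y b /\ b.2 = row_len Y b.1.

Definition corner (Y : diagram) (b : box) : Prop :=
  last_box Y b /\ forall x, boxes Y (x, b.2) -> x <= b.1.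

Definition strip (Y : diagram) (B : box) : set box :=
  [set b | last_box Y b /\ B.1 - prime_height Y B.1 + 1 <= b.1 <= B.1].

Definition covers (Y' Y : diagram) : Prop :=
  [/\ is_young Y', is_young Y &
      exists2 B, corner Y B & boxes Y' = boxes Y `\` strip Y B].

(** A filling is the list of its rows, each row being the list of its labels;
    its shape is [seq.shape T]. *)

Definition filling := seq (seq nat).

Definition entry (T : filling) (b : box) : nat :=
  nth 0 (nth [::] T b.1.-1) b.2.-1.

Definition len (T : filling) : nat := \max_(v <- flatten T) v.

Definition is_tableau (T : filling) : Prop :=
  [/\ is_young (shape T),
      forall x y, boxes (shape T) (x, y) -> boxes (shape T) (x, y.+1) ->
        entry T (x, y) < entry T (x, y.+1),
      forall x y, boxes (shape T) (x, y) -> boxes (shape T) (x.+1, y) ->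
        entry T (x, y) <= entry T (x.+1, y) &
      flatten T =i iota 1 (len T)].

(* T^(r); the rows that become empty are dropped. *)
Definition restr (r : nat) (T : filling) : filling :=
  [seq s <- [seq [seq v <- s | v <= r] | s <- T] | s != [::]].

Definition psi_tableau (T : filling) : Prop :=
  is_tableau T /\
  forall r, 1 <= r <= len T -> covers (shape (restr r.-1 T)) (shape (restr r T)).

Definition rset (T : filling) (r : nat) : set box :=
  [set b | boxes (shape T) b /\ entry T b = r].

Definition is_end_box (S : set box) (b : box) : Prop :=
  S b /\ forall b', S b' -> b'.1 <= b.1.

(* The r-set is a full-set whose end-box is (k, n - k). *)
Definition full_set_at (n : nat) (T : filling) (r k : nat) : Prop :=
  [/\ 1 <= k <= n - 1, exists y, rset T r (1, y) &
      is_end_box (rset T r) (k, n - k)].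

Definition plus_full_set (n : nat) (T : filling) (r : nat) : Prop :=
  exists2 k, full_set_at n T r k &
    k = n - 1 \/ (k <= n - 2 /\ entry T (k + 1, n - k - 1) < r).

Definition C_ (i : int) (n : nat) : set filling :=
  [set T | [/\ psi_tableau T, shape T = delta (n - 1)%N &
               (len T)%:Z = n%:Z + i]%R].

Definition F_ (i : int) (r n : nat) : set filling :=
  [set T | [/\ C_ i n T, plus_full_set n T r &
               forall j, 1 <= j < r -> ~ plus_full_set n T j]].

Definition N_ (i : int) (n : nat) : set filling :=
  [set T | C_ i n T /\ ~ exists r, plus_full_set n T r].

(** [fset_set A] is empty when A is infinite; the next lemmas show that
    [#|` fset_set A |] is the actual cardinality for the sets used here. *)

Lemma finite_fillings (Y : diagram) (l : nat) :
  finite_set [set T : filling | shape T = Y /\ len T <= l].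
Proof.
elim: Y => [|m Y IH].
  by apply: (@sub_finite_set _ _ [set [::]]) => // -[|s T] [].
have fr : finite_set [set s : seq nat | size s = m /\ all (leq^~ l) s].
  apply: (@sub_finite_set _ _ ((fun u : m.-tuple 'I_l.+1 => map val u) @` setT)).
    move=> s [/= ss /allP sl].
    have st : size [seq inord v : 'I_l.+1 | v <- s] == m by rewrite size_map ss.
    exists (Tuple st) => //=; rewrite -map_comp -[RHS]map_id.
    by apply/eq_in_map => v vs; rewrite /= inordK// ltnS sl.
  exact/finite_image/finite_finset.
apply: sub_finite_set (finite_image (fun p => p.1 :: p.2) (finite_setX fr IH)).
move=> [|s T] [//= [sm sT]]; rewrite /len /= big_cat /= geq_max => /andP[sl Tl].
exists (s, T) => //=; split=> //; split=> //.
by apply/allP => v vs; apply: leq_trans sl; apply: leq_bigmax_seq.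
Qed.

Lemma finite_C (i : int) (n : nat) : finite_set (C_ i n).
Proof.
apply: sub_finite_set (@finite_fillings (delta (n - 1)) (absz (n%:Z + i)%R)).
by move=> T [_ sT lT]; split=> //; rewrite -lT absz_nat.
Qed.

Lemma finite_N (i : int) (n : nat) : finite_set (N_ i n).
Proof. by apply: sub_finite_set (@finite_C i n) => T []. Qed.

(* Main.v *)
(** Record a tableau by which labels occur in which row, and let mu_x be the
    number of labels <= r in row x, plus x. The r-set of a psi-tableau occupies
    a block of rows x < y <= d, where the earlier rows of the block have
    mu_y < mu_d, and mu_x >= mu_d if x > 0. Hence a box (k, n - k) is always the
    end-box of its r-set.

    Write m = i + 1. The n - 1 boxes of the outer diagonal have distinct labels,
    so m of the n - 1 + m labels are off the diagonal; row 1 contains n - 1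
    labels, so at most m diagonal labels miss row 1. If the label of (k, n - k)
    is full but not plus-full then the label of (k + 1, n - k - 1) misses row 1,
    so at most m labels are of this kind. Thus one of the labels 1, ..., 3m + 1
    is plus-full.

    Conversely, given a tableau for n of length l and 1 <= j <= l + 1, let k be
    the first row completed before j; duplicating row k and inserting the label
    j in rows 1, ..., k gives a tableau for n + 1 in which j is plus-full, and
    no smaller label becomes plus-full. Starting from a tableau for n = 2m + 1
    of length 3m without plus-full-sets, this reaches every j in [3m + 1]. *)

Require Import Defs.
From mathcomp Require Import all_boot all_order all_algebra finmap.
From mathcomp Require Import boolp classical_sets functions cardinality.
From mathcomp Require Import zify.

Set Implicit Arguments.
Unset Strict Implicit.
Unset Printing Implicit Defensive.

(** * Psi-tableaux encoded by label counts per row *)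

Definition cnt (P : nat -> nat -> bool) (x r : nat) : nat :=
  count (P x) (iota 1 r).

(** Row d holds the corner box and d - x is the prime height: the third clause makes the box lowest
    in its column, the last two say that h = d - x meets the prime condition and no smaller h does.
    The case x = 0 reflects the infinite row 0. *)
Definition strip_step (P : nat -> nat -> bool) (r : nat) : Prop :=
  exists x d, [/\ x < d, forall y, P y r = (x < y <= d),
    cnt P d.+1 r < cnt P d r,
    forall y, x < y < d -> cnt P y r + y < cnt P d r + d &
    x = 0 \/ cnt P d r + d <= cnt P x r + x].

(** The second clause is the shape [delta (n - 1)]; truncated subtraction makes every row from n on
    empty. *)
Definition chain (n l : nat) (P : nat -> nat -> bool) : Prop :=
  (forall r, 0 < r <= l -> strip_step P r) /\
  forall x, 0 < x -> cnt P x l = n - x.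

(* For k = n - 1 the last equation reads 0 = 0. *)
Definition plus_full (n : nat) (P : nat -> nat -> bool) (r : nat) : Prop :=
  exists k, [/\ 0 < k < n, P 1 r, P k r, forall y, P y r -> y <= k &
    cnt P k r = n - k /\ cnt P k.+1 r.-1 = n - k - 1].

Implicit Types P : nat -> nat -> bool.

Lemma cnt0 P x : cnt P x 0 = 0. Proof. by []. Qed.

Lemma cntS P x r : cnt P x r.+1 = cnt P x r + P x r.+1.
Proof. by rewrite /cnt -(addn1 r) iotaD count_cat /= addn0 [1 + r]addnC. Qed.

Lemma cnt_pred P x r : 0 < r -> cnt P x r = cnt P x r.-1 + P x r.
Proof. by case: r => // r _; rewrite cntS. Qed.

Lemma leq_cnt P x r s : r <= s -> cnt P x r <= cnt P x s.
Proof.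
move=> /subnK <-; elim: (s - r) => // k; rewrite addSn cntS; lia.
Qed.

Lemma ltn_cnt P x r s t : r < t <= s -> P x t -> cnt P x r < cnt P x s.
Proof.
move=> /andP[rt ts] Pt; apply: leq_trans (leq_cnt P x ts).
rewrite (cnt_pred P x (leq_ltn_trans (leq0n r) rt)) Pt addn1 ltnS leq_cnt//.
by rewrite -ltnS (ltn_predK rt).
Qed.

(** The lower row can gain alone only just below row a, above which the strip stops; there mu_(a+1)
    <= mu_d <= mu_a keeps row a + 1 strictly shorter than row a. *)
Lemma cnt_monotone P l r x : (forall r, 0 < r <= l -> strip_step P r) ->
  r <= l -> 0 < x -> cnt P x.+1 r <= cnt P x r.
Proof.
move=> st; elim: r x => // r IH x rl x0.
have := IH x (ltnW rl) x0.
have /st[a [d [ad Pr c1 c2 c3]]] : 0 < r.+1 <= l by [].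
rewrite -ltnS; move: c1 c3 (c2 x.+1); rewrite !cntS !Pr.
have [?|nd] := eqVneq x d; first by subst; lia.
have [?|na] := eqVneq x a; last lia.
by subst; have [?|] := eqVneq d a.+1; subst; lia.
Qed.

(** * A plus-full label among the first 3m + 1 *)

Lemma cnt_last P x l : 0 < cnt P x l ->
  exists2 r, 0 < r <= l & P x r /\ cnt P x r = cnt P x l.
Proof.
elim: l => // l IH; rewrite cntS; case Pl: (P x l.+1).
  by exists l.+1; rewrite ?cntS ?Pl ?leqnn.
by rewrite addn0 => /IH[r rl [? ?]]; exists r => //; lia.
Qed.

(** A complete row has mu = n, while the bottom row d of the strip, being nonempty, has mu at most
    n; so row k cannot lie in the strip strictly above row d. *)
Lemma diag_end n l P k r y : chain n l P -> 0 < k -> 0 < r <= l -> P k r ->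
  cnt P k r = n - k -> k < n -> P y r -> y <= k.
Proof.
move=> [st fin] k0 rl Pk ck kn; case: (st r rl) => x [d [xd Pr c1 c2 _]].
move: Pk; rewrite !Pr => Pk Py; have := c2 k.
have : cnt P d r <= n - d by rewrite -fin ?leq_cnt; lia.
lia.
Qed.

Lemma plus_full_early n m l P :
  2 * m + 2 <= n -> l = n - 1 + m -> chain n l P ->
  exists2 r, 0 < r <= 3 * m + 1 & plus_full n P r.
Proof.
move=> nm El ch; have [st fin] := ch.
(* [e k] is the label of the diagonal box (k, n - k), at which row k becomes complete. *)
have /choice[e eP] : forall k, exists r, 0 < k < n ->
    [/\ 0 < r <= l, P k r & cnt P k r = n - k].
  move=> k; have [kn|] := boolP (0 < k < n); last by exists 0.
  have [|r rl [Pk ck]] := @cnt_last P k l; first by rewrite fin; lia.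
  by exists r => _; split; rewrite // ck fin; lia.
have e_end k y : 0 < k < n -> P y (e k) -> y <= k.
  move=> kn; have [el ? ?] := eP k kn.
  by apply: (diag_end ch) => //; lia.
have e_inj k k' : 0 < k < n -> 0 < k' < n -> e k = e k' -> k = k'.
  move=> kn kn' ee; apply/eqP; rewrite eqn_leq.
  have [_ ? _] := eP k kn; have [_ ? _] := eP k' kn'.
  by apply/andP; split; apply: e_end; rewrite // ?ee// -ee.
pose K := iota 1 (n - 1).
have KP k : (k \in K) = (0 < k < n) by rewrite mem_iota; lia.
pose D := map e K.
have uD : uniq D.
  by rewrite map_inj_in_uniq ?iota_uniq// => k k'; rewrite !KP; apply: e_inj.
have sD : size D = n - 1 by rewrite size_map size_iota.
have Dl : {subset D <= iota 1 l}.
  by move=> _ /mapP[k /[!KP] kn ->]; rewrite mem_iota; have [] := eP k kn; lia.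
pose R := filter (P 1) (iota 1 l).
have sR : size R = n - 1 by rewrite size_filter; apply: fin.
pose X := [seq r <- iota 1 l | r \notin D].
have sX : size X <= m.
  have uXD : uniq (X ++ D).
    rewrite cat_uniq filter_uniq ?iota_uniq//= uD andbT.
    by apply/hasPn => r rD; rewrite mem_filter rD.
  have /(uniq_leq_size uXD) : {subset X ++ D <= iota 1 l}.
    by move=> r; rewrite mem_cat mem_filter => /orP[/andP[]//|/Dl].
  by rewrite size_cat sD size_iota; lia.
pose Y := [seq r <- D | ~~ P 1 r].
have sY : size Y <= m.
  have uRY : uniq (R ++ Y).
    rewrite cat_uniq !filter_uniq ?iota_uniq//= andbT.
    by apply/hasPn => r; rewrite !mem_filter => /andP[/negPf->].
  have /(uniq_leq_size uRY) : {subset R ++ Y <= iota 1 l}.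
    by move=> r; rewrite mem_cat !mem_filter => /orP[/andP[]//|/andP[_ /Dl]].
  by rewrite size_cat sR size_iota El leq_add2l.
(* [A] collects the rows whose diagonal label is full but not plus-full; sending k to [e k.+1]
   injects it into [Y]. *)
pose A := [seq k <- K | P 1 (e k) && (cnt P k.+1 (e k).-1 != n - k - 1)].
have sA : size A <= m.
  apply: leq_trans sY; rewrite -(size_map (fun k => e k.+1) A).
  have AP k : k \in A ->
      [/\ 0 < k < n, 0 < k.+1 < n, ~~ P 1 (e k.+1) & P 1 (e k)].
    rewrite mem_filter KP => /andP[/andP[P1 nc] kn].
    have [kl Pk ck] := eP k kn.
    have c' r : r <= l -> cnt P k.+1 r <= n - k.+1.
      by move=> rl; rewrite -fin// leq_cnt.
    (* For k = n - 1 the row k + 1 is empty, so the inequality in [A] would read 0 != 0. *)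
    have kn1 : 0 < k.+1 < n by have := c' (e k).-1; lia.
    have [kl' Pk' ck'] := eP k.+1 kn1.
    split=> //; apply/negP => P1'.
    (* Otherwise row k + 1 would be complete before label [e k], making it plus-full. *)
    have eee : e k < e k.+1.
      rewrite ltn_neqAle; apply/andP; split.
        by apply/eqP => /(e_inj _ _ kn kn1); lia.
      rewrite leqNgt; apply/negP => lt.
      have := @leq_cnt P k.+1 (e k.+1) (e k).-1; have := c' (e k).-1; lia.
    (* A strip meeting rows 1 and k + 1 also meets row k, which is already complete at label
       [e k]. *)
    have [x [d [xd Pr _ _ _]]] := st _ kl'.
    have : P k (e k.+1) by move: P1' Pk'; rewrite !Pr; lia.
    have kr : e k < e k.+1 <= l by lia.
    by move=> /(ltn_cnt kr); rewrite fin; lia.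
  apply: uniq_leq_size.
    rewrite map_inj_in_uniq ?filter_uniq ?iota_uniq// => k k'.
    by move=> /AP[? ? _ _] /AP[? ? _ _] /e_inj; lia.
  move=> _ /mapP[k /AP[? kn nP _] ->]; rewrite mem_filter nP.
  by apply: map_f; rewrite KP.
apply: contrapT => no.
(* The bound on n gives 3m + 1 <= l. Without a plus-full label these 3m + 1 labels would fit into
   three lists of at most m entries each. *)
have : {subset iota 1 (3 * m + 1) <= X ++ Y ++ map e A}.
  move=> r; rewrite mem_iota => rm; rewrite !mem_cat.
  have rl : r \in iota 1 l by rewrite mem_iota; lia.
  rewrite mem_filter rl andbT; case rD: (r \in D) => //=.
  rewrite mem_filter rD andbT; case P1: (P 1 r) => //=.
  move: rD => /mapP[k kK re]; subst r;
    rewrite map_f// mem_filter kK P1 andbT /=.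
  apply/eqP => cc; apply: no; exists (e k); first lia.
  move: kK; rewrite KP => kn; have [? ? ?] := eP k kn.
  by exists k; split=> // y; apply: e_end.
move=> /(uniq_leq_size (iota_uniq _ _)).
rewrite size_iota !size_cat size_map.
move=> /leq_trans/(_ (leq_add sX (leq_add sY sA))).
lia.
Qed.

Definition insert_full P (k j x s : nat) : bool :=
  if s == j then 0 < x <= k
  else P (if x <= k then x else x.-1) (if s < j then s else s.-1).

Lemma cnt_insert_lt P k j x s : s < j ->
  cnt (insert_full P k j) x s = cnt P (if x <= k then x else x.-1) s.
Proof.
elim: s => // s IH sj; rewrite !cntS IH ?(ltnW sj)// /insert_full sj.
by rewrite (ltn_eqF sj).
Qed.

Lemma cnt_insert_ge P k j x s : 0 < j <= s ->
  cnt (insert_full P k j) x s =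
  cnt P (if x <= k then x else x.-1) s.-1 + (0 < x <= k).
Proof.
elim: s => [|s IH]; first lia.
rewrite [j <= _]leq_eqVlt ltnS => /andP[j0 /predU1P[js|js]].
  by rewrite cntS cnt_insert_lt -?js// /insert_full js eqxx.
have [sj sj'] : (s.+1 == j) = false /\ (s.+1 < j) = false by lia.
rewrite cntS IH ?j0//= /insert_full sj sj' /=.
by rewrite [in RHS](cnt_pred P _ (leq_trans j0 js)); lia.
Qed.

Section Insert.
Variables (P : nat -> nat -> bool) (n l k j : nat).
Hypotheses (Pch : chain n l P) (jl : 0 < j <= l.+1) (kn : 0 < k <= n).
Hypotheses (k_full : cnt P k j.-1 = n - k).
Hypotheses (k_min : forall x, 0 < x < k -> cnt P x j.-1 < n - x).

(* A strip that meets one of the rows x + 1, ..., k but not row x is stopped by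
   one of the rows x, ..., k - 1, whose mu is at most that of row x. *)
Lemma dominance_persists x r s : 0 < x -> r <= s <= l ->
  (forall y, x < y <= k -> cnt P y r + y <= cnt P x r + x) ->
  forall y, x < y <= k -> cnt P y s + y <= cnt P x s + x.
Proof.
move=> x0 /andP[rs sl] dom; elim: s rs sl => [|s IH].
  by rewrite leqn0 => /eqP <-.
rewrite leq_eqVlt => /predU1P[<-//|rs] sl y yk.
have {}IH := IH rs (ltnW sl).
have [st _] := Pch; have /st[a [d [ad Pd _ c2 c3]]] : 0 < s.+1 <= l by lia.
move: (IH y yk) (IH a) (c2 y) c3; rewrite !cntS !Pd.
by have [?|?] := eqVneq y d; have [?|?] := eqVneq a x; subst; lia.
Qed.

(* Otherwise row x would dominate row k from stage r on, so row k could not be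
   completed first. *)
Lemma strip_reaches_top x d r : 0 < r < j -> x < k <= d ->
  (forall y, x < y < d -> cnt P y r + y < cnt P d r + d) ->
  x = 0 \/ cnt P d r + d <= cnt P x r + x -> x = 0.
Proof.
move=> rj xk c2 [//|c3]; apply: contrapT => /eqP; rewrite -lt0n => x0.
have dom y : x < y <= k -> cnt P y r + y <= cnt P x r + x.
  by move=> yk; have := c2 y; have [?|] := eqVneq y d; subst; lia.
have rl : r <= j.-1 <= l by lia.
have := dominance_persists x0 rl dom (y := k).
by have := k_min (x := x); lia.
Qed.

Lemma chain_insert_full : chain n.+1 l.+1 (insert_full P k j).
Proof.
have [st fin] := Pch; split=> [s sl|x x0]; last first.
  by rewrite cnt_insert_ge//=; case: ifP => xk; rewrite fin; lia.
have [sj|js|js] := ltngtP s j.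
- have /st[x [d [xd Pd c1 c2 c3]]] : 0 < s <= l by lia.
  have P'E y : insert_full P k j y s = (x < (if y <= k then y else y.-1) <= d).
    by rewrite /insert_full sj ltn_eqF.
  have [dk|kd] := ltnP d k; last have [xk|kx] := ltnP x k.
  + exists x, d; split=> // [y|||]; rewrite ?cnt_insert_lt//.
    * by rewrite P'E; case: ifP; lia.
    * by rewrite !ifT//; lia.
    * by move=> y yd; rewrite !cnt_insert_lt// !ifT; try lia; have := c2 y; lia.
    * by rewrite !ifT//; lia.
  + have sj' : 0 < s < j by lia.
    (* Duplication raises mu by one below row k but not in row x, so mu_x >= mu_d might not survive;
       reaching the top removes that condition. *)
    have x0 : x = 0 by apply: (strip_reaches_top sj' _ c2 c3); lia.
    exists 0, d.+1; split=> // [y|||]; last by left.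
    * by rewrite P'E; case: ifP; lia.
    * by rewrite !cnt_insert_lt// !ifN /=; lia.
    * move=> y yd; rewrite !cnt_insert_lt// [in X in _ < X]ifN /=; last lia.
      case: ifP => yk; last by have := c2 y.-1; lia.
      by have := c2 y; have [?|] := eqVneq y d; subst; lia.
  + exists x.+1, d.+1; split=> // [y|||].
    * by rewrite P'E; case: ifP; lia.
    * by rewrite !cnt_insert_lt// !ifN /=; lia.
    * by move=> y yd; rewrite !cnt_insert_lt// !ifN /=; try lia;
        have := c2 y.-1; lia.
    * by rewrite !cnt_insert_lt// !ifN /=; lia.
- have /st[x [d [xd Pd c1 c2 c3]]] : 0 < s.-1 <= l by lia.
  have P'E y : insert_full P k j y s = (x < (if y <= k then y else y.-1) <= d).
    by rewrite /insert_full gtn_eqF// ltnNge (ltnW js).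
  have cE y : cnt (insert_full P k j) y s =
      cnt P (if y <= k then y else y.-1) s.-1 + (0 < y <= k).
    by apply: cnt_insert_ge; lia.
  (* Row k is complete before j, so later strips lie entirely above or entirely below it. There mu
     rises by one in every row: through label j up to row k, through the shift below it. *)
  have nk : ~~ P k s.-1.
    apply/negP => Pk; have /ltn_cnt/(_ Pk) : j.-1 < s.-1 <= l by lia.
    by rewrite k_full fin; lia.
  have [dk|kd] := ltnP d k; last have kx : k <= x by move: nk; rewrite Pd; lia.
  + exists x, d; split=> // [y|||]; rewrite ?cE.
    * by rewrite P'E; case: ifP; lia.
    * by rewrite !ifT; lia.
    * by move=> y yd; rewrite cE !ifT; try lia; have := c2 y; lia.
    * by rewrite !ifT; lia.
  + exists x.+1, d.+1; split=> // [y|||]; rewrite ?cE.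
    * by rewrite P'E; case: ifP; lia.
    * by rewrite !ifN /=; lia.
    * by move=> y yd; rewrite cE !ifN /=; try lia; have := c2 y.-1; lia.
    * by rewrite !ifN /=; lia.
- have cE y : cnt (insert_full P k j) y s =
      cnt P (if y <= k then y else y.-1) s.-1 + (0 < y <= k).
    by apply: cnt_insert_ge; lia.
  (* As k is the first complete row, label j gives it mu = n + 1, and the rows above it stay
     smaller. *)
  exists 0, k; split=> // [|y|||]; rewrite ?cE; first lia.
  + by rewrite /insert_full js eqxx.
  + by rewrite ifN ?ifT/=; lia.
  + move=> y yk; rewrite cE !ifT; try lia.
    by have := k_min (x := y); rewrite js; lia.
  + by left.
Qed.

Lemma plus_full_insert : plus_full n.+1 (insert_full P k j) j.
Proof.
exists k; rewrite /insert_full eqxx; split=> //; [lia..| |];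
  first by move=> y /andP[].
rewrite cnt_insert_ge ?cnt_insert_lt; try lia.
by rewrite leqnn ltnn /=; lia.
Qed.

Lemma plus_full_insert_lt s : 0 < s < j ->
  plus_full n.+1 (insert_full P k j) s -> plus_full n P s.
Proof.
move=> sj [k' [k'n P1 Pk' Pe]].
have P'E y : insert_full P k j y s = P (if y <= k then y else y.-1) s.
  by case/andP: sj => _ sj; rewrite /insert_full ltn_eqF// sj.
rewrite !cnt_insert_lt; try lia; move: P1 Pk' Pe.
rewrite !P'E ifT; last lia.
move=> P1 Pk' Pe [c1 c2].
have [_ fin] := Pch.
(* At stage s < j a row k' <= k carries only old labels, at most n - k', one short of the n + 1 - k'
   required. *)
have kk' : k < k'.
  rewrite ltnNge; apply/negP => kk'; move: c1; rewrite kk' => c1.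
  have : cnt P k' s <= cnt P k' j.-1 by apply: leq_cnt; lia.
  have : cnt P k' s <= cnt P k' l by apply: leq_cnt; lia.
  rewrite fin; last lia.
  by have := k_min (x := k'); have [?|] := eqVneq k k'; subst; lia.
move: Pk' c1 c2; rewrite !ifN ?(ltn_predK kk') /=; try lia.
move=> Pk' c1 c2; exists k'.-1; rewrite (ltn_predK kk'); split=> //; try lia.
move=> y Py; have [yk|yk] := leqP y k; first lia.
by have := Pe y.+1; rewrite P'E ifN ?Py; lia.
Qed.

End Insert.

Lemma insert_plus_full n l P j : chain n l P -> 0 < n -> 0 < j <= l.+1 ->
  exists P', [/\ chain n.+1 l.+1 P', plus_full n.+1 P' j &
    forall s, 0 < s < j -> plus_full n.+1 P' s -> plus_full n P s].
Proof.
move=> Pch n0 jl.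
have ex : exists k, (0 < k) && (n - k <= cnt P k j.-1).
  by exists n; rewrite n0 subnn.
case: (ex_minnP ex) => k /andP[k0 kc] kmin; have [_ fin] := Pch.
have kn : 0 < k <= n by rewrite k0 kmin// n0 subnn.
have kf : cnt P k j.-1 = n - k.
  by apply/eqP; rewrite eqn_leq kc andbT -fin// leq_cnt; lia.
have km x : 0 < x < k -> cnt P x j.-1 < n - x.
  move=> /andP[x0 xk]; rewrite ltnNge; apply/negP => h.
  by have := kmin x; rewrite x0 h; lia.
exists (insert_full P k j); split.
- exact: chain_insert_full.
- exact: plus_full_insert jl kn kf.
- by move=> s sj; apply: (plus_full_insert_lt Pch jl kn kf km).
Qed.

(** * Tableaux whose first plus-full label is j *)

(* Columns of heights 2m-1, 2m-3, ..., 1 twice, then single boxes in the rows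
   2, 4, ..., 2m. *)
Definition stair (m x r : nat) : bool :=
  (0 < x) && [|| (0 < r <= m) && (x <= 2 * (m - r) + 1),
                 (m < r <= 2 * m) && (x <= 2 * (2 * m - r) + 1) |
                 (2 * m < r <= 3 * m) && (x == 2 * (r - 2 * m))].

(** In each of the two batches row x meets the first m - x./2 columns; the last summand is the
    single box of an even row. *)
Lemma cnt_stair m x r : 0 < x ->
  cnt (stair m) x r = minn r (m - x./2) + minn (r - m) (m - x./2)
    + (~~ odd x && (x./2 + 2 * m <= r) && (x <= 2 * m)).
Proof.
move=> x0; elim: r => [|r IH]; first by rewrite cnt0; lia.
rewrite cntS {}IH /stair x0 /=; set h := x./2.
have -> : (r < m) && (x <= 2 * (m - r.+1) + 1) = (r < m - h) by rewrite /h; lia.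
have -> : (m < r.+1 <= 2 * m) && (x <= 2 * (2 * m - r.+1) + 1) =
    (m <= r) && (r - m < m - h) by rewrite /h; lia.
have -> : (2 * m < r.+1 <= 3 * m) && (x == 2 * (r.+1 - 2 * m)) =
    [&& ~~ odd x, x <= 2 * m & r.+1 == h + 2 * m] by rewrite /h; lia.
have : ~~ odd x -> 0 < h by rewrite /h; lia.
by case: (~~ odd x); case: (x <= 2 * m) => /=; lia.
Qed.

Lemma chain_stair m : chain (2 * m + 1) (3 * m) (stair m).
Proof.
split=> [r rl|x x0]; last by rewrite cnt_stair//; lia.
have [r1|r1] := leqP r m; last have [r2|r2] := leqP r (2 * m).
- exists 0, (2 * (m - r) + 1);
  split=> [|y|||]; [lia|by rewrite /stair; lia|..|by left].
  + by rewrite !cnt_stair; lia.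
  + by move=> y yd; rewrite !cnt_stair; lia.
- exists 0, (2 * (2 * m - r) + 1);
  split=> [|y|||]; [lia|by rewrite /stair; lia|..|by left].
  + by rewrite !cnt_stair; lia.
  + by move=> y yd; rewrite !cnt_stair; lia.
(* The odd row just above the single box is complete since stage 2m, so it stops the strip at
   once. *)
- exists (2 * (r - 2 * m)).-1, (2 * (r - 2 * m)).
  split=> [|y||y|]; [lia|by rewrite /stair; lia|..].
  + by rewrite !cnt_stair; lia.
  + lia.
  + by right; rewrite !cnt_stair; lia.
Qed.

(** Only columns meet row 1. Those of the first batch end short of the diagonal; those of the second
    end on it in an odd row k, but the even row k + 1 gets its last box only after stage 2m. *)
Lemma stair_not_plus_full m r : ~ plus_full (2 * m + 1) (stair m) r.
Proof.
case=> k [kn P1 Pk Pe [c1 c2]].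
have {}P1 : 0 < r <= 2 * m by move: P1; rewrite /stair; lia.
have Pe' : ~~ stair m k.+1 r by apply/negP => /Pe; rewrite ltnn.
have [r1|r1] := leqP r m.
  have ek : k = 2 * (m - r) + 1 by move: Pk Pe'; rewrite /stair;
    clear -kn P1 r1; lia.
  by move: c1; rewrite ek cnt_stair; clear -P1 r1; lia.
have ek : k = 2 * (2 * m - r) + 1 by move: Pk Pe'; rewrite /stair;
  clear -kn P1 r1; lia.
by move: c2; rewrite ek cnt_stair; clear -P1 r1; lia.
Qed.

(** Insertion at the same j is repeated from [stair m] up to size n. Labels below j never become
    plus-full, and the last insertion makes j plus-full. The stair has length 3m, so j <= 3m + 1 is
    allowed from the start. *)
Lemma exists_first_plus_full m n j : 2 * m + 2 <= n -> 0 < j <= 3 * m + 1 ->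
  exists P, [/\ chain n (n - 1 + m) P, plus_full n P j &
    forall s, 0 < s < j -> ~ plus_full n P s].
Proof.
move=> mn jm.
have step q P : 2 * m + 1 <= q -> chain q (q - 1 + m) P ->
    (forall s, 0 < s < j -> ~ plus_full q P s) ->
    exists P', [/\ chain q.+1 (q.+1 - 1 + m) P', plus_full q.+1 P' j &
      forall s, 0 < s < j -> ~ plus_full q.+1 P' s].
  move=> mq Pch nP;
    have [||P' [P'ch P'j P's]] := insert_plus_full Pch (j := j); try lia.
  exists P'; split=> // [|s sj /(P's _ sj)]; last exact: nP.
  by rewrite (_ : q.+1 - 1 + m = (q - 1 + m).+1)//; lia.
have [P Pch nP] : exists2 P, chain n.-1 (n.-1 - 1 + m) P &
    forall s, 0 < s < j -> ~ plus_full n.-1 P s.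
  have -> : n.-1 = 2 * m + 1 + (n - (2 * m + 2)) by lia.
  elim: (n - _) => [|q [P Pch nP]].
    exists (stair m); last by rewrite addn0 => s _; apply: stair_not_plus_full.
    by rewrite (_ : _ - 1 + m = 3 * m) ?addn0; [exact: chain_stair|lia].
  by rewrite addnS; have [|P' []] := step _ _ _ Pch nP; [lia|exists P'].
by have := step _ _ _ Pch nP; rewrite prednK; [apply|]; lia.
Qed.

(** * Rows of a filling and their counts *)

(** The labels at most r form a prefix of a strictly increasing row, so only its c-th label has to
    be tested. *)
Lemma leq_count_sorted (s : seq nat) (c r : nat) : sorted ltn s -> 0 < c ->
  (c <= count (leq^~ r) s) = (c <= size s) && (nth 0 s c.-1 <= r).
Proof.
elim: s c => [|x s IH] c ss c0 /=; first lia.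
have [xr|rx] := leqP x r.
  case: c c0 => [//|[|c]] _; first by rewrite /= xr.
  by rewrite add1n !ltnS IH// (path_sorted ss).
have /allP xs : all (ltn x) s by apply: order_path_min ss; apply: ltn_trans.
have -> : count (leq^~ r) s = 0.
  by apply/eqP; rewrite -leqn0 leqNgt -has_count; apply/hasPn => y /xs /=; lia.
case: c c0 => [//|[|c]] _; rewrite /=; first lia.
case: (ltnP c (size s)) => cs; last lia.
by have /= := xs _ (mem_nth 0 cs); lia.
Qed.

(** The zeros of a weakly decreasing list form its tail, and the default value 0 replaces them. This
    handles the empty rows dropped by [restr]. *)
Lemma nth_filter_pos (w : seq nat) i : sorted geq w ->
  nth 0 [seq v <- w | v != 0] i = nth 0 w i.
Proof.
elim: w i => // x w IH i xw /=; have [x0|x0] /= := eqVneq x 0; last first.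
  by case: i => //= i; apply/IH/path_sorted/xw.
have /allP w0 : all (geq x) w.
  by apply: order_path_min xw => a b c /= ab bc; apply: leq_trans bc ab.
rewrite IH ?(path_sorted xw)//; have nth0 k : nth 0 w k = 0.
  by have [/(mem_nth 0)/w0/=|/(nth_default 0)//] := ltnP k (size w); lia.
by case: i => [|i]; rewrite /= ?x0 !nth0.
Qed.

Lemma row_len_delta m y : 0 < y -> row_len (delta m) y = m.+1 - y.
Proof.
case: y => // y _; rewrite /row_len /delta /= subSS.
have [ym|ym] := ltnP y m; last by rewrite nth_default ?size_rev ?size_iota//;
  lia.
by rewrite nth_rev size_iota// nth_iota; lia.
Qed.

(** Without the guard, [y.-1] would make row 0 a copy of row 1. *)
Definition labels (T : filling) (y r : nat) : bool :=
  (0 < y) && (r \in nth [::] T y.-1).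

Lemma row_len_shape (T : filling) y :
  row_len (shape T) y = size (nth [::] T y.-1).
Proof. by rewrite /row_len nth_shape. Qed.

Lemma shape_restr r (T : filling) :
  shape (restr r T) = [seq v <- [seq count (leq^~ r) s | s <- T] | v != 0].
Proof.
rewrite /restr /shape; elim: T => //= s T IH.
by rewrite -size_filter; case: [seq v <- s | v <= r] => //= v s'; rewrite IH.
Qed.

Lemma prime_heightP (Y : diagram) d : prime_cond Y d (prime_height Y d) /\
  forall h, prime_cond Y d h -> prime_height Y d <= h.
Proof. by rewrite /prime_height; case: ex_minnP. Qed.

(** * Stages T^(r) and the covering relation *)

Section Stages.
Variables (T : filling) (l : nat).
Hypothesis rows_sorted : forall y, sorted ltn (nth [::] T y).
Hypothesis rows_pos : forall y, 0 \notin nth [::] T y.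

Lemma cnt_labels y r : 0 < y ->
  cnt (labels T) y r = count (leq^~ r) (nth [::] T y.-1).
Proof.
move=> y0; rewrite /cnt /labels y0 -!size_filter.
apply/perm_size/uniq_perm; rewrite ?filter_uniq ?iota_uniq//.
  by apply: sorted_uniq (rows_sorted _); [exact: ltn_trans|exact: ltnn].
move=> v; rewrite !mem_filter mem_iota.
by case: v => [|v]; rewrite ?(negPf (rows_pos _)) ?andbF//=; case: (_ \in _);
  lia.
Qed.

Lemma leq_cnt_labels x c r : 0 < x -> 0 < c -> (c <= cnt (labels T) x r) =
  (c <= size (nth [::] T x.-1)) && (entry T (x, c) <= r).
Proof. by move=> x0 c0; rewrite cnt_labels// leq_count_sorted. Qed.

Hypothesis cnt_mono : forall y r, 0 < y -> r <= l ->
  cnt (labels T) y.+1 r <= cnt (labels T) y r.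

Lemma counts_sorted r : r <= l -> sorted geq [seq count (leq^~ r) s | s <- T].
Proof.
move=> rl; apply/(sortedP 0) => i; rewrite size_map => iT.
rewrite !(nth_map [::])//; last exact: ltnW.
by rewrite /= -(@cnt_labels i.+1)// -(@cnt_labels i.+2)// cnt_mono.
Qed.

Lemma row_len_restr r y : r <= l -> 0 < y ->
  row_len (shape (restr r T)) y = cnt (labels T) y r.
Proof.
move=> rl y0; rewrite /row_len shape_restr nth_filter_pos ?counts_sorted//.
rewrite cnt_labels//; have [yT|yT] := ltnP y.-1 (size T).
  by rewrite (nth_map [::]).
by rewrite !nth_default ?size_map.
Qed.

Lemma young_restr r : r <= l -> is_young (shape (restr r T)).
Proof.
move=> rl; rewrite /is_young shape_restr mem_filter eqxx andbT.
apply: sorted_filter (counts_sorted rl) => a b c /= ab bc.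
exact: leq_trans bc ab.
Qed.

Lemma boxes_restr r y c : r <= l -> boxes (shape (restr r T)) (y, c) <->
  0 < y /\ 0 < c <= cnt (labels T) y r.
Proof.
move=> rl; rewrite /boxes /=; split=> -[y0 /=]; rewrite row_len_restr//.
Qed.

Lemma cnt_mono_le y z r : 0 < y <= z -> r <= l ->
  cnt (labels T) z r <= cnt (labels T) y r.
Proof.
move=> /andP[y0 /subnKC <-] rl; elim: (z - y) => [|k IH];
  first by rewrite addn0.
by rewrite addnS (leq_trans _ IH)// cnt_mono// addn_gt0 y0.
Qed.

Lemma strip_restr r d c y : r <= l -> 0 < y -> 0 < cnt (labels T) y r ->
  let Y := shape (restr r T) in
  strip Y (d, c) (y, cnt (labels T) y r) <-> d - prime_height Y d < y <= d.
Proof.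
move=> rl y0 cy Y; rewrite /strip /last_box /= addn1; split=> [[]//|h].
by split=> //; split; [apply/boxes_restr;
  rewrite // cy leqnn|rewrite row_len_restr].
Qed.

Lemma strip_step_of_covers r : 0 < r <= l ->
  covers (shape (restr r.-1 T)) (shape (restr r T)) -> strip_step (labels T) r.
Proof.
set P := labels T; move=> /andP[r0 rl].
have rl' : r.-1 <= l by lia.
case=> _ _ [[d c] [[dcY] /=]]; rewrite /= row_len_restr//; last by case: dcY.
rewrite -/P => cE low bE; move: dcY => /boxes_restr-/(_ rl)[d0];
  rewrite -/P => cd.
have [hc hmin] := prime_heightP (shape (restr r T)) d.
have sE y := @strip_restr r d c y rl.
move: hc hmin sE bE; set h := prime_height _ _; rewrite -/P /= => hc hmin sE bE.
have hd : h <= d by apply: hmin; rewrite /prime_cond d0 subnn.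
have h0 : 0 < h by case/andP: hc.
have pc k : 0 < k < d -> prime_cond (shape (restr r T)) d k =
    (cnt P d r + k <= cnt P (d - k) r).
  move=> kd; rewrite /prime_cond !row_len_restr//; last lia.
  by rewrite -/P; case: (cnt _ _ _ + _ <= _); lia.
(* With h the prime height, its minimality gives the strict inequalities inside the strip and the
   prime condition at h gives the last clause. *)
exists (d - h), d; split=> [|y||y yd|]; first lia.
- case: y => [|y]; first by rewrite /P/labels; lia.
  (* Row y + 1 gains label r exactly when its last box in T^(r) is deleted, so the equality of box
     sets is tested at that box. *)
  have := cnt_pred P y.+1 r0;
    have := congr1 (fun A : set box => A (y.+1, cnt P y.+1 r)) bE.
  rewrite propeqE => -[b1 b2] cS.
  case Py: (P y.+1 r) cS => cS.
    apply/esym/(sE y.+1) => //; first by rewrite -/P; lia.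
    apply: contrapT => ns;
      have /b2 : boxes (shape (restr r T)) (y.+1, cnt P y.+1 r)
        /\ ~ strip (shape (restr r T)) (d, c) (y.+1, cnt P y.+1 r).
      by split=> //; apply/boxes_restr => //; rewrite -/P; lia.
    by move=> /boxes_restr-/(_ rl'); rewrite -/P; lia.
  apply/esym/negP => yd.
  have cy : cnt P d r <= cnt P y.+1 r by apply: cnt_mono_le; lia.
  have /b1[_] : boxes (shape (restr r.-1 T)) (y.+1, cnt P y.+1 r).
    by apply/boxes_restr => //; rewrite -/P; lia.
  by apply; apply/(sE y.+1) => //; rewrite -/P; lia.
- rewrite ltnNge; apply/negP => cd'.
  have : boxes (shape (restr r T)) (d.+1, c) by apply/boxes_restr => //;
    rewrite -/P; lia.
  by move=> /low /=; rewrite ltnn.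
- rewrite ltnNge; apply/negP => cy.
  by have := hmin (d - y); rewrite pc ?subKn; lia.
- have [hd'|] := ltnP h d; last lia.
  by right; move: hc; rewrite pc; lia.
Qed.

Lemma covers_of_strip_step r : 0 < r <= l -> strip_step (labels T) r ->
  covers (shape (restr r.-1 T)) (shape (restr r T)).
Proof.
set P := labels T; move=> /andP[r0 rl] [x [d [xd Pd c1 c2 c3]]].
have rl' : r.-1 <= l by lia.
have [hc hmin] := prime_heightP (shape (restr r T)) d.
have sE y := @strip_restr r d (cnt P d r) y rl.
move: hc hmin sE; set h := prime_height _ _; rewrite -/P /= => hc hmin sE.
have pc k : 0 < k < d -> prime_cond (shape (restr r T)) d k =
    (cnt P d r + k <= cnt P (d - k) r).
  move=> kd; rewrite /prime_cond !row_len_restr//; try lia.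
  by rewrite -/P; case: (cnt _ _ _ + _ <= _); lia.
have h0 : 0 < h by case/andP: hc.
(* [c3] shows that d - x meets the prime condition, and [c2] excludes smaller heights. *)
have hE : h = d - x.
  apply/eqP; rewrite eqn_leq hmin /=; last first.
    have [?|x0] := eqVneq x 0; first by subst;
      rewrite /prime_cond subn0 subnn xd.
    by rewrite pc ?subKn; lia.
  rewrite leqNgt; apply/negP => hx; move: hc; rewrite pc; last lia.
  by have := c2 (d - h); lia.
split; [exact: young_restr..|exists (d, cnt P d r)].
  split; first split.
  - by apply/boxes_restr => //; rewrite -/P; lia.
  - by rewrite /= row_len_restr//; lia.
  move=> y /boxes_restr-/(_ rl)[y0] /=; rewrite -/P => cy.
  rewrite leqNgt; apply/negP => dy.
  have : cnt P y r <= cnt P d.+1 r by apply: cnt_mono_le; lia.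
  lia.
have cS y := cnt_pred P y r0.
apply/seteqP; split=> -[y c].
  move=> /boxes_restr-/(_ rl')[y0]; rewrite -/P => cy; have := cS y.
  split; first by apply/boxes_restr => //; rewrite -/P; lia.
  case=> -[_] /=; rewrite row_len_restr// -/P => cE; rewrite -/h hE addn1.
  by rewrite subKn ?(ltnW xd)// => yd; have := Pd y; rewrite yd; lia.
move=> [/boxes_restr-/(_ rl)[y0]]; rewrite -/P => cy ns.
apply/boxes_restr => //; rewrite -/P; split=> //; have := cS y.
have [cE|] := eqVneq c (cnt P y r); last by case: (P y r); lia.
move=> cS'; have : ~~ (P y r); last by lia.
apply/negP => Py; apply: ns; rewrite cE; apply/sE => //; first by lia.
by have := Pd y; rewrite Py -/h hE; lia.
Qed.

End Stages.

(** * Translation between C_i(n) and chains *)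

Lemma C_chain i n T : 0 < n -> C_ i n T ->
  [/\ forall y, sorted ltn (nth [::] T y), forall y, 0 \notin nth [::] T y,
      forall y, 0 < y -> size (nth [::] T y.-1) = n - y &
      chain n (len T) (labels T)].
Proof.
move=> n0 [[[young rows cols flat] psi] sT lT].
have sz y : 0 < y -> size (nth [::] T y.-1) = n - y.
  by move=> y0; rewrite -row_len_shape sT row_len_delta//; lia.
have bx y c : boxes (shape T) (y, c) <-> 0 < y /\ 0 < c <= n - y.
  by rewrite /boxes /=; split=> -[y0]; rewrite row_len_shape sz.
have srt y : sorted ltn (nth [::] T y).
  apply/(sortedP 0) => k kT; apply: (rows y.+1 k.+1); apply/bx; split=> //.
    by rewrite -sz//=; lia.
  by rewrite -sz.
have lab y r : r \in nth [::] T y -> 0 < r <= len T.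
  move=> rT; have : r \in flatten T.
    apply/flattenP; exists (nth [::] T y) => //; apply: mem_nth.
    by rewrite ltnNge; apply/negP => yT; move: rT; rewrite nth_default.
  by rewrite flat mem_iota; lia.
have pos y : 0 \notin nth [::] T y by apply/negP => /lab.
have mono y r : 0 < y -> r <= len T ->
    cnt (labels T) y.+1 r <= cnt (labels T) y r.
  move=> y0 _; set c := cnt _ y.+1 r; have [->//|c0] := posnP c.
  have := leqnn c; rewrite {2}/c leq_cnt_labels// sz// => /andP[cy er].
  rewrite leq_cnt_labels// sz//; apply/andP; split; first lia.
  by apply: leq_trans er; apply: cols; apply/bx; lia.
split=> //; split=> [r rl|y y0].
  by apply: (strip_step_of_covers srt pos mono rl); apply: psi.
rewrite cnt_labels// -sz//; apply/eqP; rewrite -all_count; apply/allP => v /lab.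
by case/andP.
Qed.

Lemma plus_full_labels i n T r : 0 < n -> C_ i n T ->
  plus_full_set n T r <-> plus_full n (labels T) r.
Proof.
move=> n0 CT; have [srt pos sz [_ fin]] := C_chain n0 CT.
have rP x : labels T x r <-> exists y, rset T r (x, y).
  rewrite /labels /rset /boxes /entry /=; split=> [/andP[x0 rT]|[y]].
    exists (index r (nth [::] T x.-1)).+1;
      rewrite row_len_shape /= index_mem rT.
    by rewrite nth_index.
  rewrite row_len_shape => -[[-> /andP[y0 yT] <-]] /=.
  by apply: mem_nth; rewrite prednK.
(* The label of a diagonal box is at most s exactly when its row is complete at stage s. *)
have last_leq x s : 0 < x < n -> (n - x <= cnt (labels T) x s) =
    (entry T (x, n - x) <= s).
  by move=> xn; rewrite leq_cnt_labels ?sz ?leqnn//; lia.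
have c_le x s : 0 < x -> cnt (labels T) x s <= n - x.
  by move=> x0; rewrite cnt_labels// -sz// count_size.
have r0 x : labels T x r -> 0 < r.
  by case/andP => _; rewrite lt0n; apply: contraTneq => ->; apply: pos.
split=> [[k [k1 /rP P1 [[kb ke] kmax]] kp]|[k [kn P1 Pk Pe [c1 c2]]]].
  have kn : 0 < k < n by lia.
  have Pk : labels T k r by apply/rP; exists (n - k).
  exists k; split=> //; first by move=> y /rP[c /kmax].
  split.
    by apply/eqP; rewrite eqn_leq c_le ?last_leq ?ke ?leqnn//; lia.
  case: kp => [kE|[kn2 ek]].
    by have := c_le k.+1 r.-1; rewrite kE; lia.
  apply/eqP; rewrite eqn_leq; apply/andP; split;
    first by have := c_le k.+1 r.-1; lia.
  have -> : n - k - 1 = n - k.+1 by lia.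
  rewrite last_leq; last lia.
  by move: ek; rewrite addn1 (_ : n - k - 1 = n - k.+1); lia.
exists k.
  split; [lia|exact/rP|split=> [|[x y] xy]]; last by apply/Pe/rP; exists y.
  split; first by rewrite /boxes /= row_len_shape sz; lia.
  apply/eqP; rewrite eqn_leq -last_leq// c1 leqnn /= leqNgt.
  (* Were this label below r, row k would be complete before r and then gain one label too many. *)
  apply/negP => lt; have := last_leq k r.-1 kn;
    have := cnt_pred (labels T) k (r0 _ Pk).
  by rewrite Pk c1; lia.
have [|kn2] := eqVneq k (n - 1); [by left|right; split; first lia].
have := last_leq k.+1 r.-1; rewrite c2 addn1 (_ : n - k - 1 = n - k.+1);
  last lia.
by rewrite leqnn; have := r0 _ Pk; lia.
Qed.

(** Row y of the tableau lists the labels up to l that P puts there. Beyond l the predicate P is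
    unconstrained, so labels are compared only up to l. *)
Lemma chain_C i n l P : 0 < n -> (l%:Z = n%:Z + i)%R -> chain n l P ->
  exists2 T, C_ i n T &
    forall r, 0 < r <= l -> plus_full_set n T r <-> plus_full n P r.
Proof.
move=> n0 lE Pch; have [st fin] := Pch.
pose T := mkseq (fun y => [seq r <- iota 1 l | P y.+1 r]) (n - 1).
have P_lt y r : 0 < y -> 0 < r <= l -> P y r -> y < n.
  move=> y0 rl /(@ltn_cnt P y 0 l r rl); rewrite fin//; lia.
have nT y : nth [::] T y = [seq r <- iota 1 l | P y.+1 r].
  have [yn|yn] := ltnP y (n - 1); first by rewrite nth_mkseq.
  rewrite nth_default ?size_mkseq//; apply/esym/eqP;
    rewrite -size_eq0 size_filter.
  by rewrite -[count _ _]/(cnt P y.+1 l) fin//; lia.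
have srt y : sorted ltn (nth [::] T y).
  by rewrite nT sorted_filter ?iota_ltn_sorted//; apply: ltn_trans.
have pos y : 0 \notin nth [::] T y by rewrite nT mem_filter mem_iota andbF.
have labE y r : 0 < r <= l -> labels T y r = P y r.
  move=> rl; case: y => [|y]; rewrite /labels ?nT ?mem_filter ?mem_iota /=.
    by have [x [d [_ -> _ _ _]]] := st r rl.
  by rewrite andbC; have -> : 0 < r < 1 + l by lia.
have cntE y r : r <= l -> cnt (labels T) y r = cnt P y r.
  by move=> rl; apply: eq_in_count => s; rewrite mem_iota => sr; apply: labE;
    lia.
have mono y r : 0 < y -> r <= l -> cnt (labels T) y.+1 r <= cnt (labels T) y r.
  by move=> y0 rl; rewrite !cntE//; apply: cnt_monotone st rl y0.
have sz y : 0 < y -> size (nth [::] T y.-1) = n - y.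
  by move=> y0; rewrite nT prednK// size_filter; apply: fin.
have flat : flatten T =i iota 1 l.
  move=> r; apply/flattenP/idP => [[s /mapP[y _ ->]]|].
    by rewrite mem_filter => /andP[].
  rewrite mem_iota => rl; have {}rl : 0 < r <= l by lia.
  have [x [d [xd Pd _ _ _]]] := st r rl.
  have Pdr : P d r by rewrite Pd; lia.
  have d0 : 0 < d by lia.
  have dn := P_lt _ _ d0 rl Pdr.
  exists (nth [::] T d.-1).
    by apply: mem_nth; rewrite size_mkseq; lia.
  by rewrite nT prednK// mem_filter Pdr mem_iota; lia.
have lenE : len T = l.
  apply/eqP; rewrite eqn_leq; apply/andP; split.
    by apply/bigmax_leqP_seq => v; rewrite flat mem_iota; lia.
  have [->//|l0] := posnP l.
  by apply: (@leq_bigmax_seq _ (flatten T) xpredT id l);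
    rewrite ?flat ?mem_iota//; lia.
have sT : shape T = delta (n - 1).
  apply: (@eq_from_nth _ 0); rewrite size_map size_mkseq ?size_rev ?size_iota//.
  move=> y yn; rewrite nth_shape -[y]/(y.+1.-1) sz//.
  by rewrite -[RHS]/(row_len (delta (n - 1)) y.+1) row_len_delta//; lia.
have bx y c : boxes (shape T) (y, c) <-> 0 < y /\ 0 < c <= n - y.
  by rewrite /boxes /=; split=> -[y0]; rewrite row_len_shape sz.
have CT : C_ i n T.
  split; [split; first split|exact: sT|by rewrite lenE].
  - apply/andP; split; last by rewrite sT mem_rev mem_iota.
    apply/(sortedP 0) => y _; rewrite !nth_shape.
    by rewrite /= (sz y.+2)// (sz y.+1)//; lia.
  - move=> y c /bx[y0 cy] /bx[_ cy1]; rewrite /entry /=.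
    case: c cy cy1 => [//|c] cy cy1.
    by have /(sortedP 0) := srt y.-1; apply; rewrite sz//; lia.
  - move=> y c /bx[y0 cy] /bx[_ cy1]; set e := entry T (y.+1, c).
    have c0 : 0 < c by lia.
    have el : e <= l.
      have : e \in iota 1 l.
        have : e \in nth [::] T y.+1.-1.
          by apply: mem_nth; rewrite sz//=; lia.
        by rewrite nT mem_filter => /andP[].
      by rewrite mem_iota; lia.
    (* At stage e row y + 1 has at least c labels, hence so does row y, whose c-th label is then at
       most e. *)
    have : c <= cnt (labels T) y.+1 e by rewrite leq_cnt_labels// sz// /e leqnn andbT; lia.
    by move=> /leq_trans/(_ (mono y e y0 el));
      rewrite leq_cnt_labels// => /andP[].
  - by rewrite lenE.
  move=> r; rewrite lenE => rl; apply: covers_of_strip_step (rl) _ => //.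
  have [x [d [xd Pd c1 c2 c3]]] := st r rl.
  have rl' : r <= l by lia.
  exists x, d; split=> // [y||y yd|]; rewrite ?labE ?cntE//.
  exact: c2.
exists T => // r rl; rewrite (plus_full_labels _ n0 CT).
have rl' : r <= l /\ r.-1 <= l by lia.
case: rl' => rl' rl''.
by split=> -[k [kn P1 Pk Pe [k1 k2]]]; exists k; move: P1 Pk k1 k2;
  rewrite !labE// !cntE// => P1 Pk k1 k2; split=> // y;
  have := Pe y; rewrite labE.
Qed.

(** * Decomposition by the first plus-full label *)

Local Open Scope classical_set_scope.
Local Open Scope ring_scope.

Theorem theorem5p8 (i : int) (hi : -1 <= i) (n : nat) (hn : 2 * i + 4 <= n%:Z) :
  [/\ (0 < #|` fset_set (C_ i n)|)%N,
      (forall T, C_ i n T -> exists r, plus_full_set n T r) /\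
        #|` fset_set (N_ i n)| = 0%N
    & let J := [set j : nat | (1 <= j)%N /\ j%:Z <= 3 * i + 4] in
      [/\ C_ i n = \bigcup_(j in J) F_ i j n,
          trivIset J (fun j => F_ i j n)
        & forall j, J j -> F_ i j n !=set0]].
Proof.
(* With m = i + 1 the length is n - 1 + m, the bound on n reads 2m + 2 <= n, and 3i + 4 = 3m + 1. *)
have [m mE] : exists m : nat, i = m%:Z - 1 by exists (absz (i + 1)); lia.
have n0 : (0 < n)%N by lia.
have nm : (2 * m + 2 <= n)%N by lia.
have early T : C_ i n T -> exists2 r, (0 < r <= 3 * m + 1)%N & plus_full_set n T r.
  move=> CT; have [_ _ _ Tch] := C_chain n0 CT.
  have lE : (len T = n - 1 + m)%N by case: CT => _ _; lia.
  have [r rm /(plus_full_labels r n0 CT) ?] := plus_full_early nm lE Tch.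
  by exists r.
have nonempty j : (0 < j <= 3 * m + 1)%N -> F_ i j n !=set0.
  move=> jm; have [P [Pch Pj Ps]] := exists_first_plus_full nm jm.
  have [|T CT TP] := @chain_C i n _ P n0 _ Pch; first by lia.
  exists T; split=> // [|s sj]; first by apply/TP => //; lia.
  by move/TP => h; apply: (Ps s sj); apply: h; lia.
have CN0 : N_ i n = set0.
  by apply/seteqP; split=> // T [/early[r _ Tr] []]; exists r.
split; last split.
- have [T [CT _ _]] := nonempty 1%N ltac:(lia).
  rewrite cardfs_gt0; apply/eqP => /(congr1 (fun A => T \in A)).
  by rewrite in_fset_set ?in_fset0 ?mem_set//; apply: finite_C.
- split=> [T /early[r _ ?]|]; first by exists r.
  by rewrite CN0 fset_set0 cardfs0.
- apply/seteqP; split=> [T CT|T [j _ []]//].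
  (* T belongs to the class of its least plus-full label, which [early] bounds by 3m + 1. *)
  have ex : exists r, `[< plus_full_set n T r >] && (0 < r)%N.
    by have [r rm /asboolP Tr] := early T CT; exists r; rewrite Tr; lia.
  case: (ex_minnP ex) => j /andP[/asboolP Tj j0] jmin.
  have [r rm /asboolP Tr] := early T CT.
  have jr : (j <= r)%N by apply: jmin; rewrite Tr; lia.
  exists j; first by split; lia.
  split=> // s sj /asboolP Ts.
  by have := jmin s; rewrite Ts; lia.
- move=> j k [j0 _] [k0 _] [T [[_ Tj jmin] [_ Tk kmin]]].
  have [jk|kj|//] := ltngtP j k; first by case: (kmin j _ Tj); rewrite j0.
  by case: (jmin k _ Tk); rewrite k0.
- by move=> j [j0 jm]; apply: nonempty; lia.
Qed.
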